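(* In any metric space, let a cloud $C'$ be obtained from a cloud $C$ of $m$ points by perturbing each point within its $\varepsilon$-neighborhood. For any integer $h$ with $1\le h<m$, $\mathrm{SDD}(C;h)$ changes by at most $2\varepsilon$ in the $\mathrm{LAC}$ and $\mathrm{EMD}$ metrics, that is, $$\mathrm{LAC}\big(\mathrm{SDD}(C;h),\mathrm{SDD}(C';h)\big)\le2\varepsilon\quad\text{and}\quad\mathrm{EMD}\big(\mathrm{SDD}(C;h),\mathrm{SDD}(C';h)\big)\le2\varepsilon.$$ Moreover, the following lower bound holds: $$\mathrm{EMD}\big(\mathrm{SDD}(C;h),\mathrm{SDD}(C';h)\big)\ \ge\ |\mathrm{SDM}(C;h,1)-\mathrm{SDM}(C';h,1)|_\infty.$$
   Context: A cloud is a finite set of unlabelled (distinct, unordered) points in a metric space with metric $d$. That $C'$ is obtained from $C$ by perturbing each point within its $\varepsilon$-neighborhood means that $C'$ is a cloud of $m$ points in the same metric space and there is a bijection $C\to C'$, $p\mapsto p'$, with $d(p,p')\le\varepsilon$ for all $p\in C$. For a vector $v$, $|v|_\infty=\|v\|_\infty=\max_i|v_i|$. Relative Distance Distribution. Let $C$ be a cloud of $m$ points and $1\le h<m$. A basis sequence $A=(p_1,\dots,p_h)\in C^h$ consists of $h$ distinct points. $D(A)$ is the triangular distance matrix whose entry $D(A)_{i,j-1}$ is $d(p_i,p_j)$ for $1\le i<j\le h$, all other entries being $0$ (for $h=1$ it is empty). A permutation $\xi\in S_h$ acts on $D(A)$ by moving the entry attached to the pair of indices $\{i,j\}$ to the position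 attached to the pair $\{\xi(i),\xi(j)\}$. For every $q\in C\setminus A$, write the distances $d(q,p_1),\dots,d(q,p_h)$ as a column; $R(C;A)$ is the $h\times(m-h)$ matrix formed by these $m-h$ columns in lexicographic order. A permutation $\xi\in S_h$ acts on $R(C;A)$ by moving the $i$-th row to the $\xi(i)$-th row, after which the columns are again written in lexicographic order. $\mathrm{RDD}(C;A)$ is the equivalence class of the pair $[D(A),R(C;A)]$ under the simultaneous action of permutations $\xi\in S_h$ on both matrices. $\mathrm{SDD}(C;h)$ is the unordered collection (with multiplicities) of $\mathrm{RDD}(C;A)$ over all $k=\binom{m}{h}$ unordered $h$-point subsets $A\subset C$, each with weight $\frac1k$ (for EMD, $s>1$ identical RDDs may be collapsed into one RDD of weight $s/k$). Metric $M_\infty$ on RDDs. For matrices $N,N'$ of the same size, $L_\infty(N,N')=\max_{i,j}|N_{ij}-N'_{ij}|$ (taken as $0$ for empty matrices). For two unordered collections $P,P'$ of $n$ points in $\mathbb{R}^h$, the bottleneck distance is $W_\infty(P,P')=\inf_{g:P\to P'}\sup_{p\in P}\|p-g(p)\|_\infty$ over all bijections $g$. The $m-h$ columns of $R(C;A)$ are regarded as an unordered collection (with multiplicities) of $m-h$ points in $\mathbb{R}^h$. For ordered $h$-point sequences $A\subset C$, $A'\subset C'$ and $\xi\in S_h$, set $d(\xi)=\max\{L_\infty(\xi(D(A)),D(A')),\,W_\infty(\xi(R(C;A)),R(C';A'))\}$, and $M_\infty(\mathrm{RDD}(C;A),\mathrm{RDD}(C';A'))=\min_{\xi\in S_h}d(\xi)$.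 Metrics on SDDs. For a $k\times k$ matrix of costs $c(i,j)\ge0$, the Linear Assignment Cost is $\mathrm{LAC}=\frac1k\min_g\sum_{i=1}^k c(i,g(i))$ over all bijections $g$ of $\{1,\dots,k\}$; $\mathrm{LAC}(\mathrm{SDD}(C;h),\mathrm{SDD}(C';h))$ uses the costs $M_\infty$ between the $k$ RDDs of $\mathrm{SDD}(C;h)$ and the $k$ RDDs of $\mathrm{SDD}(C';h)$. For finite unordered sets $B=\{B_i\}$ and $D=\{D_j\}$ of objects with weights $w(B_i)$, $w(D_j)$ and a metric $d(B_i,D_j)$ between objects, the Earth Mover's Distance $\mathrm{EMD}(B,D)$ is the minimum of $\sum_{i,j}f_{ij}\,d(B_i,D_j)$ over $f_{ij}\in[0,1]$ subject to $\sum_{j}f_{ij}\le w(B_i)$ for all $i$, $\sum_i f_{ij}\le w(D_j)$ for all $j$, and $\sum_{i,j}f_{ij}=1$; on SDDs the metric between objects (RDDs) is $M_\infty$. First Simplexwise Distance Moment. For an $h$-point subset $A\subset C$, $\mathrm{SDV}(A)$ is the list of all $\frac{h(h-1)}{2}$ pairwise distances between points of $A$ in increasing order; $\vec R(C;A)\in\mathbb{R}^{m-h}$ is the vector of the $m-h$ column averages of $R(C;A)$ written in increasing order. $\mathrm{ADD}(C;A)$ is the concatenated vector $[\mathrm{SDV}(A);\vec R(C;A)]$ of length $\frac{h(h-3)}{2}+m$. $\mathrm{SDM}(C;h,1)$ is the coordinatewise average of the $\binom{m}{h}$ vectors $\mathrm{ADD}(C;A)$ over all unordered $h$-point subsets $A\subset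 C$. *)

(* Defs.v *)
From HB Require Import structures.
From mathcomp Require Import all_boot all_order all_algebra all_fingroup.
From mathcomp Require Import finmap multiset generic_quotient.
From mathcomp Require Import all_classical all_reals all_analysis.

Set Implicit Arguments.
Unset Strict Implicit.
Unset Printing Implicit Defensive.
Set Warnings "-notation-overridden,-ambiguous-paths".

Import Order.TTheory GRing.Theory Num.Theory.
Import numFieldNormedType.Exports.

Local Open Scope fset_scope.
Local Open Scope mset_scope.
Local Open Scope quotient_scope.
Local Open Scope ring_scope.

(* A cloud in [T : metricType R] is a finite set [C : {fset T}].  The
   cardinalities of [C] and [C'] agree because [f] is bijective. *)
Definition perturbation (R : realType) (T : metricType R) (eps : R)
    (C C' : {fset T}) : Prop :=
  exists f : C -> C',
    bijective f /\ forall p : C, mdist (val p) (val (f p)) <= eps.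

Section PairMatrices.
Variables (R : realType) (h : nat).
Implicit Types (D : 'M[R]_(h.-1)) (xi : 'S_h).

(* With indices counted from 0, the pair of points i < j of a sequence of length
   h sits in row i and column j - 1 of an (h - 1) x (h - 1) matrix.  Conversely
   the position (a, b) with a <= b is attached to the pair (lo a, hi b), i.e.
   (a, b + 1); the positions with b < a are attached to no pair. *)
Definition lo (a : 'I_h.-1) : 'I_h := widen_ord (leq_pred h) a.

Lemma hi_subproof (b : 'I_h.-1) : (b.+1 < h)%N.
Proof. by rewrite -ltn_predRL. Qed.

Definition hi (b : 'I_h.-1) : 'I_h := Ordinal (hi_subproof b).

(* the entry of D attached to the pair {i, j}, for i != j *)
Definition pair_entry D (i j : 'I_h) : R :=
  if insub (minn i j) is Some a then
    if insub (maxn i j).-1 is Some b then D a b else 0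
  else 0.

(* Moves the entry attached to {i, j} to the position attached to
   {xi i, xi j}; entries attached to no pair stay where they are. *)
Definition permD xi D : 'M[R]_(h.-1) :=
  \matrix_(a, b) if (a <= b)%N
                 then pair_entry D ((xi^-1)%g (lo a)) ((xi^-1)%g (hi b))
                 else D a b.

Lemma pair_entryC D i j : pair_entry D i j = pair_entry D j i.
Proof. by rewrite /pair_entry minnC maxnC. Qed.

Lemma pair_entry_lohi D (a b : 'I_h.-1) : (a <= b)%N ->
  pair_entry D (lo a) (hi b) = D a b.
Proof.
move=> ab; rewrite /pair_entry /=.
have -> : minn a b.+1 = val a by apply/minn_idPl; exact: leqW.
have -> : (maxn a b.+1).-1 = val b by rewrite (maxn_idPr _) //; exact: leqW.
by rewrite !valK.
Qed.

Lemma lohiP (i j : 'I_h) : i != j ->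
  exists a b : 'I_h.-1, (a <= b)%N /\
    ((i = lo a /\ j = hi b) \/ (i = hi b /\ j = lo a)).
Proof.
wlog ij : i j / (i < j)%N.
  move=> H nij; have [ij|ji|/val_inj e] := ltngtP i j; first exact: H.
    have [|a [b [ab H']]] := H j i ji; first by rewrite eq_sym.
    by exists a, b; split=> //; case: H' => -[-> ->]; [right|left].
  by rewrite e eqxx in nij.
move=> _; have hj := ltn_ord j.
have j0 : (0 < j)%N by apply: leq_ltn_trans ij.
have ib : (i < h.-1)%N by rewrite ltn_predRL; apply: leq_ltn_trans hj.
have jb : (j.-1 < h.-1)%N by rewrite ltn_predRL prednK.
exists (Ordinal ib), (Ordinal jb); split => /=; first by rewrite -ltnS prednK.
by left; split; apply: val_inj => //=; rewrite prednK.
Qed.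

Lemma pair_entry_perm xi D i j : i != j ->
  pair_entry (permD xi D) i j = pair_entry D ((xi^-1)%g i) ((xi^-1)%g j).
Proof.
move=> /lohiP [a [b [ab [[-> ->]|[-> ->]]]]].
  by rewrite pair_entry_lohi // mxE ab.
by rewrite pair_entryC pair_entry_lohi // mxE ab pair_entryC.
Qed.

Lemma lo_neq_hi (a b : 'I_h.-1) : (a <= b)%N -> lo a != hi b.
Proof. by move=> ab; rewrite -val_eqE /= neq_ltn ltnS ab. Qed.

Lemma permD1 D : permD 1%g D = D.
Proof.
apply/matrixP => a b; rewrite mxE invg1 !perm1; case: ifP => // ab.
by rewrite pair_entry_lohi.
Qed.

Lemma permDM xi eta D : permD xi (permD eta D) = permD (eta * xi)%g D.
Proof.
apply/matrixP => a b; rewrite mxE [RHS]mxE; case: ifP => ab; last by rewrite mxE ab.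
rewrite pair_entry_perm ?(inj_eq perm_inj) ?lo_neq_hi //.
by rewrite invMg !permM.
Qed.

Lemma permDB xi D E : permD xi (D - E) = permD xi D - permD xi E.
Proof.
apply/matrixP => a b; rewrite !mxE; case: ifP => // _; rewrite /pair_entry.
case: insubP => [u _ _|_]; last by rewrite subr0.
by case: insubP => [v _ _|_]; rewrite ?mxE // subr0.
Qed.

End PairMatrices.

Section Entries.
Variables (R : realType).

Lemma mx_norm_entry p q (N : 'M[R]_(p, q)) i j : `|N i j| <= `|N|.
Proof.
rewrite {2}/Num.norm /= mx_normrE.
exact: (le_bigmax _ (fun ij : 'I_p * 'I_q => `|N ij.1 ij.2|) (i, j)).
Qed.

Lemma mx_norm_le p q (N : 'M[R]_(p, q)) (c : R) : 0 <= c ->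
  (forall i j, `|N i j| <= c) -> `|N| <= c.
Proof.
move=> c0 H; rewrite /Num.norm /= mx_normrE.
by apply/bigmax_leP; split => // -[i j] _; exact: H.
Qed.

Lemma norm_permD_le h (xi : 'S_h) (D : 'M[R]_(h.-1)) : `|permD xi D| <= `|D|.
Proof.
apply: mx_norm_le => // a b; rewrite mxE; case: ifP => _.
  rewrite /pair_entry; case: insubP => [u _ _|_]; last by rewrite normr0.
  by case: insubP => [v _ _|_]; rewrite ?normr0 // mx_norm_entry.
exact: mx_norm_entry.
Qed.

Lemma norm_permD h (xi : 'S_h) (D : 'M[R]_(h.-1)) : `|permD xi D| = `|D|.
Proof.
apply/eqP; rewrite eq_le norm_permD_le /=.
by rewrite -{1}[D]permD1 -(mulgV xi) -permDM norm_permD_le.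
Qed.

Lemma norm_row_perm p q (s : 'S_p) (N : 'M[R]_(p, q)) :
  `|row_perm s N| = `|N|.
Proof.
have le (t : 'S_p) (M : 'M[R]_(p, q)) : `|row_perm t M| <= `|M|.
  by apply: mx_norm_le => // i j; rewrite mxE mx_norm_entry.
apply/eqP; rewrite eq_le le /=.
by rewrite -{1}[N]row_perm1 -(mulVg s) row_permM le.
Qed.

End Entries.

Section ColumnCollections.
Variables (R : realType) (h n : nat).
Implicit Types (M N : 'M[R]_(h, n)) (xi : 'S_h).

Definition col_tuple M (j : 'I_n) : h.-tuplelexi R := [tuple M i j | i < h].

Definition cols M : n.-tuple (h.-tuplelexi R) := [tuple col_tuple M j | j < n].

(* rearranges the columns in lexicographic order *)
Definition sort_cols M : 'M[R]_(h, n) :=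
  let s : n.-tuple (h.-tuplelexi R) := [tuple of sort <=%O (cols M)] in
  \matrix_(i, j) tnth (tnth s j) i.

(* [row_perm (xi^-1) M] has the i-th row of M as its (xi i)-th row *)
Definition permR xi M : 'M[R]_(h, n) := sort_cols (row_perm (xi^-1)%g M).

(* Bottleneck distance between the collections of n columns of M and N, which
   are compared in the sup norm of R^h; bijections between the two collections
   are permutations of the column indices.  The seed of the minimum is the value
   at the identity. *)
Definition bottleneck_cost M N (g : 'S_n) : R :=
  \big[Num.max/0]_(j < n) `|col j M - col (g j) N|.

Definition Winf M N : R :=
  \big[Num.min/bottleneck_cost M N 1%g]_(g : 'S_n) bottleneck_cost M N g.

Lemma cols_inj M N : cols M = cols N -> M = N.
Proof.
move=> e; apply/matrixP => i j.
have := congr1 (fun s => tnth (tnth s j) i) e.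
by rewrite !tnth_map !tnth_ord_tuple.
Qed.

Lemma cols_sort_cols M : cols (sort_cols M) = sort <=%O (cols M) :> seq _.
Proof.
pose s : n.-tuple (h.-tuplelexi R) := [tuple of sort <=%O (cols M)].
suff -> : cols (sort_cols M) = s by [].
apply: eq_from_tnth => j; rewrite tnth_map tnth_ord_tuple.
apply: eq_from_tnth => i; rewrite tnth_map tnth_ord_tuple mxE.
by [].
Qed.

Lemma sort_colsP M N :
  reflect (exists t : 'S_n, N = col_perm t M) (sort_cols M == sort_cols N).
Proof.
apply: (iffP eqP) => [e|[t ->]].
  have : perm_eq (cols N) (cols M).
    rewrite -(perm_sort <=%O) -cols_sort_cols -e cols_sort_cols.
    by rewrite perm_sort.
  case/tuple_permP => t /val_inj et; exists t; apply: cols_inj; rewrite et.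
  apply: eq_from_tnth => j; rewrite !tnth_map !tnth_ord_tuple.
  by apply: eq_from_tnth => i; rewrite !tnth_map !tnth_ord_tuple mxE.
apply/cols_inj/val_inj; rewrite /= -[LHS]/(tval _) -[RHS]/(tval _).
rewrite !cols_sort_cols; apply/perm_sortP; last first.
- rewrite perm_sym; apply/tuple_permP; exists t; congr val.
  apply: eq_from_tnth => j; rewrite !tnth_map !tnth_ord_tuple.
  by apply: eq_from_tnth => i; rewrite !tnth_map !tnth_ord_tuple mxE.
- exact: le_anti.
- exact: le_trans.
- exact: le_total.
Qed.

Lemma sort_cols_perm M : exists t : 'S_n, sort_cols M = col_perm t M.
Proof.
apply/sort_colsP/eqP/esym/cols_inj/val_inj.
rewrite -[LHS]/(tval _) -[RHS]/(tval _) !cols_sort_cols.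
by apply/sorted_sort/sort_sorted; [exact: le_trans|exact: le_total].
Qed.

Lemma Winf_le M N M' N' (s : 'S_n -> 'S_n) :
  (forall g, bottleneck_cost M N (s g) <= bottleneck_cost M' N' g) ->
  Winf M N <= Winf M' N'.
Proof.
move=> H; apply/bigmin_geP; split => [|g _].
  by apply: le_trans (H 1%g); exact: bigmin_le_cond.
by apply: le_trans (H g); exact: bigmin_le_cond.
Qed.

Lemma bottleneck_ge0 M N g : 0 <= bottleneck_cost M N g.
Proof. by apply/bigmax_geP; left. Qed.

Lemma Winf_col_perm M N (t u : 'S_n) :
  Winf (col_perm t M) (col_perm u N) = Winf M N.
Proof.
have cE (P : 'M[R]_(h, n)) v j : col j (col_perm v P) = col (v j) P.
  by apply/colP => i; rewrite !mxE.
apply/eqP; rewrite eq_le; apply/andP; split.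
  apply: (@Winf_le _ _ _ _ (fun g => t * g * u^-1)%g) => g.
  apply/bigmax_leP; split => [|j _]; first exact: bottleneck_ge0.
  rewrite !cE !permM permKV.
  exact: (le_bigmax _ (fun k => `|col k M - col (g k) N|)).
apply: (@Winf_le _ _ _ _ (fun g => t^-1 * g * u)%g) => g.
apply/bigmax_leP; split => [|j _]; first exact: bottleneck_ge0.
rewrite !permM -cE -[in col j M](permKV t j) -cE.
exact: (le_bigmax _ (fun k => `|col k (col_perm t M) -
                                col (g k) (col_perm u N)|)).
Qed.

Lemma Winf_row_perm M N (s : 'S_h) :
  Winf (row_perm s M) (row_perm s N) = Winf M N.
Proof.
have e g : bottleneck_cost (row_perm s M) (row_perm s N) g =
           bottleneck_cost M N g.
  apply: eq_bigr => j _; rewrite -[RHS](norm_row_perm s); congr `|_|.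
  by apply/colP => i; rewrite !mxE.
by rewrite /Winf e; apply: eq_bigr => g _; rewrite e.
Qed.

Lemma Winf_permR M N xi eta :
  Winf (permR xi M) (permR eta N) =
  Winf (row_perm (xi^-1)%g M) (row_perm (eta^-1)%g N).
Proof.
rewrite /permR; have [t ->] := sort_cols_perm (row_perm (xi^-1)%g M).
by have [u ->] := sort_cols_perm (row_perm (eta^-1)%g N); rewrite Winf_col_perm.
Qed.

Lemma sort_cols_id M : sort_cols (sort_cols M) = sort_cols M.
Proof.
have [t e] := sort_cols_perm M; rewrite {1}e; apply/eqP; rewrite eq_sym.
by apply/sort_colsP; exists t.
Qed.

Lemma permR1 M : permR 1%g M = sort_cols M.
Proof. by rewrite /permR invg1 row_perm1. Qed.

Lemma permRM xi eta M : permR xi (permR eta M) = permR (eta * xi)%g M.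
Proof.
rewrite /permR; have [t ->] := sort_cols_perm (row_perm (eta^-1)%g M).
have -> : row_perm (xi^-1)%g (col_perm t (row_perm (eta^-1)%g M)) =
    col_perm t (row_perm (eta * xi)^-1%g M).
  by apply/matrixP => i j; rewrite !mxE invMg permM.
apply/eqP; rewrite eq_sym.
by apply/sort_colsP; exists t.
Qed.

Lemma permR_sort xi M : permR xi (sort_cols M) = permR xi M.
Proof. by rewrite -permR1 permRM mul1g. Qed.

End ColumnCollections.

Section RelativeDistanceDistributions.
Variables (R : realType) (h n : nat).

Definition matpair := ('M[R]_(h.-1) * 'M[R]_(h, n))%type.
HB.instance Definition _ := Choice.on matpair.

Implicit Types x y z : matpair.

(* x and y are exchanged by a simultaneous action of some xi.  Sorting the
   columns of [y.2] changes nothing for the pairs [D(A), R(C; A)], and makes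
   this an equivalence relation on all pairs of matrices. *)
Definition matpair_eqv : rel matpair := fun x y =>
  [exists xi : 'S_h, (permD xi x.1 == y.1) && (permR xi x.2 == sort_cols y.2)].

Lemma matpair_eqv_refl : reflexive matpair_eqv.
Proof. by move=> x; apply/existsP; exists 1%g; rewrite permD1 permR1 !eqxx. Qed.

Lemma matpair_eqv_sub x y : matpair_eqv x y -> matpair_eqv y x.
Proof.
case/existsP => xi /andP[/eqP eD /eqP eR]; apply/existsP; exists (xi^-1)%g.
by rewrite -eD permDM mulgV permD1 eqxx -permR_sort -eR permRM mulgV permR1 /=.
Qed.

Lemma matpair_eqv_sym : symmetric matpair_eqv.
Proof. by move=> x y; apply/idP/idP; exact: matpair_eqv_sub. Qed.

Lemma matpair_eqv_trans : transitive matpair_eqv.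
Proof.
move=> y x z /existsP[xi /andP[/eqP eD /eqP eR]].
case/existsP => eta /andP[/eqP eD' /eqP eR'].
apply/existsP; exists (xi * eta)%g.
by rewrite -permDM eD eD' eqxx -permRM eR permR_sort eR' /=.
Qed.

Canonical matpair_equiv :=
  EquivRel matpair_eqv matpair_eqv_refl matpair_eqv_sym matpair_eqv_trans.

Definition rdd := {eq_quot matpair_eqv}.
HB.instance Definition _ : EqQuotient _ matpair_eqv rdd := EqQuotient.on rdd.
HB.instance Definition _ := Choice.on rdd.

Definition dxi x y (xi : 'S_h) : R :=
  Num.max `|permD xi x.1 - y.1| (Winf (permR xi x.2) y.2).

(* The seed of the minimum is the value at the identity. *)
Definition Minf_pair x y : R :=
  \big[Num.min/dxi x y 1%g]_(xi : 'S_h) dxi x y xi.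

(* Independent of the representatives, see [Minf_pi] below. *)
Definition Minf (X Y : rdd) : R := Minf_pair (repr X) (repr Y).

Lemma Minf_pair_le x y x' y' (s : 'S_h -> 'S_h) :
  (forall xi, dxi x y (s xi) <= dxi x' y' xi) ->
  Minf_pair x y <= Minf_pair x' y'.
Proof.
move=> H; apply/bigmin_geP; split => [|g _].
  by apply: le_trans (H 1%g); exact: bigmin_le_cond.
by apply: le_trans (H g); exact: bigmin_le_cond.
Qed.

Lemma dxi_eqv x y x' y' eta zeta xi :
    permD eta x.1 = x'.1 -> permR eta x.2 = sort_cols x'.2 ->
    permD zeta y.1 = y'.1 -> permR zeta y.2 = sort_cols y'.2 ->
  dxi x y (eta * xi * zeta^-1)%g = dxi x' y' xi.
Proof.
move=> eD eR eD' eR'; rewrite /dxi; congr Num.max.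
  rewrite -(norm_permD zeta) permDB permDM -mulgA mulVg mulg1 -permDM.
  by rewrite eD eD'.
have Wsort P Q : Winf P (sort_cols Q) = Winf P Q :> R.
  have [t ->] := sort_cols_perm Q.
  by rewrite -[P in LHS]col_perm1 Winf_col_perm.
rewrite -[in RHS]permR_sort -eR permRM -[RHS]Wsort -eR' Winf_permR.
rewrite -Wsort -permR1 Winf_permR invg1 row_perm1.
rewrite -[LHS](Winf_row_perm _ _ (zeta^-1)%g) -row_permM.
by congr (Winf (row_perm _ _) _); rewrite !invMg invgK mulgA mulVg mul1g.
Qed.

Lemma Minf_pair_eqv_le x y x' y' : matpair_eqv x x' -> matpair_eqv y y' ->
  Minf_pair x y <= Minf_pair x' y'.
Proof.
case/existsP => eta /andP[/eqP eD /eqP eR].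
case/existsP => zeta /andP[/eqP eD' /eqP eR'].
apply: (@Minf_pair_le _ _ _ _ (fun xi => eta * xi * zeta^-1)%g) => xi.
by rewrite (dxi_eqv _ eD eR eD' eR').
Qed.

Lemma Minf_pi x y : Minf (\pi_(rdd) x) (\pi_(rdd) y) = Minf_pair x y.
Proof.
have e z : matpair_eqv (repr (\pi_(rdd) z)) z.
  by apply/(@eqquotP _ matpair_eqv rdd); exact: reprK.
apply/eqP; rewrite eq_le /Minf !Minf_pair_eqv_le //;
  by rewrite matpair_eqv_sym.
Qed.

End RelativeDistanceDistributions.

Section Clouds.
Variables (R : realType) (T : metricType R).
Implicit Types C : {fset T}.

Definition DM h (A : h.-tuple T) : 'M[R]_(h.-1) :=
  \matrix_(a, b) if (a <= b)%N then mdist (tnth A (lo a)) (tnth A (hi b)) else 0.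

(* n is meant to be the number #|C| - h of points of C outside A *)
Definition RM n C h (A : h.-tuple T) : 'M[R]_(h, n) :=
  sort_cols (\matrix_(i, j)
    [seq mdist q (tnth A i) | q <- enum_fset C & q \notin A]`_j).

Definition RDD n C h (A : h.-tuple T) : rdd R h n :=
  \pi_(rdd R h n) (DM A, RM n C A).

(* Each h-point subset of C, listed once, as a sequence in some order:
   [pmap insub] keeps exactly the sequences of size h. *)
Definition basis_seqs h C : seq (h.-tuple T) :=
  pmap insub [seq enum_fset A | A <- enum_fset (fpowerset C)].

(* m is meant to be #|C| *)
Definition SDD m h C : {mset rdd R h (m - h)} :=
  seq_mset [seq RDD (m - h) C A | A <- basis_seqs h C].

Definition SDV h (A : h.-tuple T) : 'rV[R]_('C(h, 2)) :=
  \row_i (sort <=%O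
    [seq mdist (tnth A ij.1) (tnth A ij.2) |
      ij : 'I_h * 'I_h <- enum {: 'I_h * 'I_h} & (ij.1 < ij.2)%N])`_i.

Definition Rvec n C h (A : h.-tuple T) : 'rV[R]_n :=
  \row_j (sort <=%O
    [seq h%:R^-1 * \sum_(i < h) RM n C A i l | l : 'I_n])`_j.

(* of length h (h - 1) / 2 + (m - h) = h (h - 3) / 2 + m, with n = m - h *)
Definition ADD n C h (A : h.-tuple T) : 'rV[R]_('C(h, 2) + n) :=
  row_mx (SDV A) (Rvec n C A).

Definition SDM m h C : 'rV[R]_('C(h, 2) + (m - h)) :=
  'C(m, h)%:R^-1 *: \sum_(A <- basis_seqs h C) ADD (m - h) C A.

End Clouds.

Section TransportCosts.
Variable R : realType.

Definition LAC k (c : 'M[R]_k) : R :=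
  k%:R^-1 * \big[Num.min/(\sum_i c i i)]_(g : 'S_k) \sum_i c i (g i).

Definition flow (I J : finType) (w : I -> R) (w' : J -> R)
    (f : I -> J -> R) : Prop :=
  [/\ forall i j, 0 <= f i j <= 1,
      forall i, \sum_j f i j <= w i,
      forall j, \sum_i f i j <= w' j
    & \sum_i \sum_j f i j = 1].

(* The infimum is a minimum: flows form a compact set. *)
Definition EMD (I J : finType) (w : I -> R) (w' : J -> R)
    (d : I -> J -> R) : R :=
  inf [set \sum_i \sum_j f i j * d i j | f in [set f | flow w w' f]]%classic.

Variables m h : nat.
Local Notation k := 'C(m, h).
Implicit Types S : {mset rdd R h (m - h)}.

(* A multiset of k RDDs is listed in an arbitrary order, on which LAC and EMD do
   not depend.  The default of [nth] is never used when S has k elements. *)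
Definition SDD_cost S S' : 'M[R]_k :=
  let x0 := \pi_(rdd R h (m - h)) (0, 0) in
  \matrix_(i, j) Minf (nth x0 (enum_mset S) i) (nth x0 (enum_mset S') j).

Definition LAC_SDD S S' : R := LAC (SDD_cost S S').

Definition EMD_SDD S S' : R :=
  EMD (fun _ : 'I_k => k%:R^-1) (fun _ : 'I_k => k%:R^-1) (SDD_cost S S').

End TransportCosts.

(* Main.v *)
(* Upper bounds: the bijection C -> C' carries each h-point subset A of C to a
   subset of C', and every distance changes by at most 2 eps by the triangle
   inequality; matching A with its image gives an assignment all of whose costs
   are at most 2 eps, and an assignment is a flow, so EMD <= LAC.
   Lower bound: sorting two lists does not increase their sup distance, hence
   ADD is 1-Lipschitz from M_infinity to the sup norm.  SDM is the barycentre of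
   the ADD vectors, and barycentres of a 1-Lipschitz map differ by at most the
   cost of any flow between the two distributions. *)
Require Import Defs.
From mathcomp Require Import all_boot all_order all_algebra all_fingroup.
From mathcomp Require Import finmap multiset generic_quotient.
From mathcomp Require Import all_classical all_reals all_analysis.
From mathcomp Require Import lra.

Set Implicit Arguments.
Unset Strict Implicit.
Unset Printing Implicit Defensive.

Import Order.TTheory GRing.Theory Num.Theory.

Local Open Scope fset_scope.
Local Open Scope ring_scope.


(** * Order statistics of lists and reindexing by permutations *)

Lemma nth_sort_le (R : realDomainType) (c : R) (s t : seq R) (i : nat) :
    size s = size t -> (forall j, (j < size s)%N -> t`_j <= s`_j + c) ->
  (i < size s)%N -> (sort <=%O t)`_i <= (sort <=%O s)`_i + c.
Proof.
(* More than [i] entries of [s] are at most [x]; each gives an entry of [t] at most [x + c]. So more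
   than [i] entries of [t] are at most [x + c], which bounds the [i]-th smallest. *)
move=> est le_ts ilt; set x := (sort _ s)`_i.
apply: nth_count_le; first exact/sort_sorted/le_total.
have le_count (u v : seq R) : size u = size v ->
    (forall j, (j < size u)%N -> v`_j <= u`_j + c) ->
    (count (<= x)%R u <= count (<= (x + c)%R)%R v)%N.
  elim: u v => [|y u IH] [|z v] //= [euv] H; apply: leq_add; last first.
    by apply: IH => // j jlt; exact: (H j.+1).
  case: (leP y x) => //= yx; have -> // : z <= x + c.
  by rewrite (le_trans (H 0%N isT)) // lerD2r.
rewrite count_sort (leq_trans _ (le_count _ _ est le_ts)) //.
rewrite -(count_sort <=%O) ltnNge; apply/negP => cle.
have := @nth_count_gt _ _ x 0 (sort <=%O s) i.
rewrite sort_sorted ?cle ?size_sort ?ilt; last exact: le_total.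
by move=> /(_ isT isT); rewrite ltxx.
Qed.

Lemma nth_sort_dist (R : realDomainType) (c : R) (s t : seq R) (i : nat) :
    0 <= c -> size s = size t ->
    (forall j, (j < size s)%N -> `|s`_j - t`_j| <= c) ->
  `|(sort <=%O s)`_i - (sort <=%O t)`_i| <= c.
Proof.
(* Past the common length both entries are the default 0, and [c0] concludes. *)
move=> c0 est H; have [ilt|ige] := ltnP i (size s); last first.
  by rewrite !nth_default ?size_sort -?est // subrr normr0.
rewrite ler_distlC; apply/andP; split.
  rewrite lerBlDr; apply: nth_sort_le; rewrite -?est // => j jlt.
  by have := H j jlt; rewrite ler_distlC lerBlDr => /andP[].
apply: nth_sort_le => // j jlt.
by have := H j jlt; rewrite ler_distlC => /andP[].
Qed.

(** A multiset is listed in an unspecified order; this traces each listed element back to the tuple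
    entry it comes from. *)
Lemma perm_map_index (X : eqType) (Y : Type) (x0 : X) (k : nat) (F : Y -> X)
    (b : k.-tuple Y) (s : seq X) :
  perm_eq s (map F b) ->
  exists p : 'S_k, forall i : 'I_k, nth x0 s i = F (tnth b (p i)).
Proof.
move=> /(@tuple_permP _ _ _ (map_tuple F b))[p ->]; exists p => i.
by rewrite -tnth_nth !tnth_map tnth_ord_tuple.
Qed.

Lemma eq_perm_bij (n : nat) (A : eqType) (F : 'I_n -> A) (t : 'S_n) :
  perm_eq [seq F (t i) | i <- enum 'I_n] [seq F i | i <- enum 'I_n].
Proof.
rewrite (map_comp F t); apply: perm_map; apply: uniq_perm.
- by rewrite map_inj_uniq ?enum_uniq //; exact: perm_inj.
- exact: enum_uniq.
move=> i; rewrite mem_enum inE; apply/mapP; exists (t^-1 i)%g.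
  by rewrite mem_enum.
by rewrite permKV.
Qed.

(** * Assignments, flows and the Earth Mover's Distance *)

Section Transport.
Variable R : realType.

Lemma LAC_le (k : nat) (c : 'M[R]_k) (g : 'S_k) (e : R) : (0 < k)%N ->
  (forall i, c i (g i) <= e) -> LAC c <= e.
Proof.
move=> k0 H; rewrite /LAC ler_pdivrMl ?ltr0n //.
apply: le_trans (_ : \sum_i c i (g i) <= _); first exact: bigmin_le_cond.
apply: le_trans (ler_sum _ (fun i _ => H i)) _.
by rewrite sumr_const card_ord mulr_natl.
Qed.

(** This turns an assignment into a competitor in the infimum [EMD], whose cost is the average cost
    of the assignment. *)
Lemma flow_perm (k : nat) (g : 'S_k) : (0 < k)%N ->
  flow (fun=> k%:R^-1) (fun=> k%:R^-1)
    (fun i j => if j == g i then k%:R^-1 else 0 : R).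
Proof.
move=> k0; have kV : 0 <= (k%:R^-1 : R) <= 1.
  by rewrite invr_ge0 ler0n invf_le1 ?ltr0n // ler1n.
have sr i : \sum_j (if j == g i then k%:R^-1 else 0 : R) = k%:R^-1.
  by rewrite -big_mkcond big_pred1_eq.
split=> [i j|i|j|]; first by case: ifP => // _; rewrite lexx ler01.
- by rewrite sr.
- rewrite -big_mkcond (big_pred1 (g^-1 j)%g) // => i.
  by rewrite /= -(can2_eq (permK g) (permKV g)) eq_sym.
rewrite (eq_bigr _ (fun i _ => sr i)) sumr_const card_ord.
by rewrite -[LHS]mulr_natl mulfV // pnatr_eq0 -lt0n.
Qed.

Lemma EMD_le (I J : finType) (w : I -> R) (w' : J -> R) (d : I -> J -> R)
    (f : I -> J -> R) : (forall i j, 0 <= d i j) -> flow w w' f ->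
  EMD w w' d <= \sum_i \sum_j f i j * d i j.
Proof.
move=> d0 wf; apply: ge_inf; last by exists f.
(* A real infimum is below the members of its set only if the set has a lower bound; nonnegative
   costs provide 0. *)
exists 0 => _ [f' [f01 _ _ _] <-].
by apply: sumr_ge0 => i _; apply: sumr_ge0 => j _; rewrite mulr_ge0 //;
   case/andP: (f01 i j).
Qed.

Lemma EMD_le_LAC (k : nat) (c : 'M[R]_k) : (0 < k)%N ->
  (forall i j, 0 <= c i j) ->
  EMD (fun=> k%:R^-1) (fun=> k%:R^-1) c <= LAC c.
Proof.
move=> k0 c0; rewrite /LAC ler_pdivlMl ?ltr0n //.
have H (g : 'S_k) : k%:R * EMD (fun=> k%:R^-1) (fun=> k%:R^-1) c <=
    \sum_i c i (g i).
  rewrite -ler_pdivlMl ?ltr0n //.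
  apply: le_trans (EMD_le c0 (flow_perm g k0)) _.
  rewrite mulr_sumr; apply: ler_sum => i _.
  rewrite (bigD1 (g i)) //= eqxx big1 ?addr0 // => j /negPf ->.
  by rewrite mul0r.
apply/bigmin_geP; split=> [|g _]; last exact: H.
(* The seed of the minimum in [LAC] is the cost of the identity. *)
by have := H 1%g; under eq_bigr do rewrite perm1.
Qed.

(** The gaps [w i - x i] are nonnegative and sum to 0, so each vanishes. *)
Lemma marginals_eq (I : finType) (w x : I -> R) :
  (forall i, x i <= w i) -> \sum_i w i = \sum_i x i -> x =1 w.
Proof.
move=> le_xw e i; apply/esym/eqP; rewrite -subr_eq0; apply/eqP.
apply: (@psumr_eq0P _ _ xpredT (fun i => w i - x i)) => // [j _|].
  by rewrite subr_ge0.
by rewrite sumrB e subrr.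
Qed.

(* Total mass 1 forces the marginals of a flow to be [w] and [w'], so the
   difference of the two averages is the flow average of [a i - b j]. *)
Lemma EMD_ge_dist (V : normedModType R) (I J : finType) (w : I -> R)
    (w' : J -> R) (d : I -> J -> R) (a : I -> V) (b : J -> V) :
    (forall i, 0 <= w i) -> (forall j, 0 <= w' j) ->
    \sum_i w i = 1 -> \sum_j w' j = 1 ->
    (forall i j, `|a i - b j| <= d i j) ->
  `|\sum_i w i *: a i - \sum_j w' j *: b j| <= EMD w w' d.
Proof.
move=> w0 w'0 w1 w'1 H; apply: lb_le_inf.
  (* The product of the two distributions is a flow, so the infimum is over a nonempty set. *)
  eexists; exists (fun i j => w i * w' j); last by [].
  have le1 (K : finType) (u : K -> R) i : (forall i, 0 <= u i) ->
      \sum_i u i = 1 -> u i <= 1.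
    by move=> u0 <-; rewrite (bigD1 i) //= lerDl sumr_ge0.
  split=> [i j|i|j|]; first by rewrite mulr_ge0 //= mulr_ile1 // le1.
  - by rewrite -mulr_sumr w'1 mulr1.
  - by rewrite -mulr_suml w1 mul1r.
  by under eq_bigr do rewrite -mulr_sumr w'1 mulr1.
move=> _ [f [f01 fw fw' f1] <-].
have ew := marginals_eq fw (etrans w1 (esym f1)).
have ew' : (fun j => \sum_i f i j) =1 w'.
  by apply: marginals_eq fw' _; rewrite w'1 -f1 exchange_big.
have -> : \sum_i w i *: a i - \sum_j w' j *: b j =
    \sum_i \sum_j f i j *: (a i - b j).
  under eq_bigr do rewrite -ew scaler_suml.
  under [X in _ - X]eq_bigr do rewrite -ew' scaler_suml.
  rewrite [X in _ - X]exchange_big -sumrB; apply: eq_bigr => i _.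
  by rewrite -sumrB; apply: eq_bigr => j _; rewrite scalerBr.
apply: le_trans (ler_norm_sum _ _ _) _; apply: ler_sum => i _.
apply: le_trans (ler_norm_sum _ _ _) _; apply: ler_sum => j _.
have /andP[f0 _] := f01 i j.
by rewrite normrZ ger0_norm // ler_wpM2l.
Qed.

End Transport.


(** * Sorted column averages are 1-Lipschitz for the bottleneck distance *)

Section ColumnAverages.
Variables (R : realType) (h n : nat).
Implicit Types M N : 'M[R]_(h, n).

Definition col_avg M (l : 'I_n) : R := h%:R^-1 * \sum_(i < h) M i l.

(** This is [Rvec] for an arbitrary matrix, so that it also applies after rows and columns are
    permuted. *)
Definition sorted_avgs M : 'rV[R]_n :=
  \row_j (sort <=%O [seq col_avg M l | l : 'I_n])`_j.

Lemma sorted_avgs_col_perm (t : 'S_n) M :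
  sorted_avgs (col_perm t M) = sorted_avgs M.
Proof.
apply/rowP => j; rewrite !mxE; congr (_`_ _).
apply/perm_sort_leP.
have -> : [seq col_avg (col_perm t M) l | l : 'I_n] =
    [seq col_avg M (t l) | l <- enum 'I_n].
  by apply: eq_map => l; rewrite /col_avg; under eq_bigr do rewrite mxE.
exact: eq_perm_bij.
Qed.

Lemma sorted_avgs_row_perm (s : 'S_h) M :
  sorted_avgs (row_perm s M) = sorted_avgs M.
Proof.
apply/rowP => j; rewrite !mxE; congr ((sort _ _)`_ _); apply: eq_map => l.
rewrite /col_avg [in RHS](reindex_inj (@perm_inj _ s)) /=; congr (_ * _).
by apply: eq_bigr => i _; rewrite mxE.
Qed.

Lemma sorted_avgs_permR (xi : 'S_h) M :
  sorted_avgs (permR xi M) = sorted_avgs M.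
Proof.
rewrite /permR; have [t ->] := sort_cols_perm (row_perm (xi^-1)%g M).
by rewrite sorted_avgs_col_perm sorted_avgs_row_perm.
Qed.

Lemma sorted_avgs_dist M N : `|sorted_avgs M - sorted_avgs N| <= Winf M N.
Proof.
have H (g : 'S_n) : `|sorted_avgs M - sorted_avgs N| <= bottleneck_cost M N g.
  (* Permuting the columns of [N] by [g] leaves its sorted averages alone and puts matched columns
     at equal indices, so sorted lists can be compared through unsorted ones. *)
  rewrite -(sorted_avgs_col_perm g N).
  have c0 := bottleneck_ge0 M N g.
  apply: mx_norm_le => // i0 j; rewrite !mxE.
  apply: nth_sort_dist => //; first by rewrite !size_map.
  move=> l; rewrite size_map -cardE card_ord => ln.
  rewrite !(nth_map (Ordinal ln)) -?enumT -?cardE ?card_ord //.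
  have -> : nth (Ordinal ln) (enum 'I_n) l = Ordinal ln.
    by apply: val_inj; rewrite /= nth_enum_ord.
  rewrite /col_avg -mulrBr -sumrB normrM ger0_norm ?invr_ge0 //.
  have Hl i : `|M i (Ordinal ln) - (col_perm g N) i (Ordinal ln)| <=
      bottleneck_cost M N g.
    rewrite /bottleneck_cost; apply: le_trans; last first.
      exact: (le_bigmax _ (fun j => `|col j M - col (g j) N|) (Ordinal ln)).
    by have := mx_norm_entry (col (Ordinal ln) M - col (g (Ordinal ln)) N) i 0;
       rewrite !mxE.
  (* For [h = 0] the inverse of [h] is 0, hence so is the difference of averages. *)
  have [h_0|h0] := posnP h.
    by have -> : h%:R = 0 :> R; rewrite ?invr0 ?mul0r // h_0.
  rewrite ler_pdivrMl ?ltr0n //; apply: le_trans (ler_norm_sum _ _ _) _.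
  apply: le_trans (ler_sum _ (fun i _ => Hl i)) _.
  by rewrite sumr_const card_ord mulr_natl.
by apply/bigmin_geP; split=> [|g _].
Qed.

End ColumnAverages.

(** * Sorted pairwise distances are 1-Lipschitz and permutation invariant *)

Section PairDistances.
Variables (R : realType) (h : nat).
Implicit Types D E : 'M[R]_(h.-1).

Definition lt_pairs : seq ('I_h * 'I_h) :=
  [seq ij : 'I_h * 'I_h <- enum {: 'I_h * 'I_h} | (ij.1 < ij.2)%N].

(** This reads [SDV] off a matrix, where [permD] acts. *)
Definition sorted_pairs D : 'rV[R]_('C(h, 2)) :=
  \row_i (sort <=%O [seq pair_entry D ij.1 ij.2 | ij <- lt_pairs])`_i.

(** A permutation may reverse a pair, so the image is put back in increasing order. The resulting
    map is an injection of a finite list into itself. *)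
Lemma perm_lt_pairs (xi : 'S_h) :
  perm_eq [seq (if (xi ij.1 < xi ij.2)%N then (xi ij.1, xi ij.2)
                else (xi ij.2, xi ij.1)) | ij <- lt_pairs] lt_pairs.
Proof.
set psi := fun ij : 'I_h * 'I_h => _.
have lt_in ij : (ij \in lt_pairs) = (ij.1 < ij.2)%N.
  by rewrite mem_filter mem_enum andbT.
have ulp : uniq lt_pairs by rewrite filter_uniq ?enum_uniq.
(* If just one of two pairs with equal images is swapped, they are reverses of each other and cannot
   both be increasing. *)
have psi_inj : {in lt_pairs &, injective psi}.
  move=> [i j] [k l]; rewrite !lt_in /psi /= => ij kl.
  case: ifP => _; case: ifP => _ [] /perm_inj e1 /perm_inj e2; subst => //.
    by have := ltn_trans ij kl; rewrite ltnn.
  by have := ltn_trans ij kl; rewrite ltnn.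
have psi_sub : {subset map psi lt_pairs <= lt_pairs}.
  move=> x /mapP[[i j]]; rewrite lt_in /psi /= => ij ->.
  case: ifP => H; rewrite lt_in //= ltn_neqAle leqNgt H andbT.
  by rewrite val_eqE (inj_eq perm_inj) -val_eqE neq_ltn ij orbT.
have upsi : uniq (map psi lt_pairs) by rewrite map_inj_in_uniq.
apply: uniq_perm => //.
by case: (uniq_min_size upsi psi_sub _); rewrite ?size_map.
Qed.

(** The action only reindexes unordered pairs by [xi^-1], and [pair_entry] is symmetric, so the list
    of entries is merely reordered. *)
Lemma sorted_pairs_permD (xi : 'S_h) D :
  sorted_pairs (permD xi D) = sorted_pairs D.
Proof.
apply/rowP => i; rewrite !mxE; congr (_`_ _); apply/perm_sort_leP.
have := perm_map (fun ij => pair_entry D ij.1 ij.2) (perm_lt_pairs (xi^-1)%g).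
apply: perm_trans; rewrite -map_comp; apply/seq.permP => a; congr (count _ _).
apply/eq_in_map => -[k l]; rewrite mem_filter /= => /andP[kl _].
rewrite pair_entry_perm; last by rewrite -val_eqE neq_ltn kl.
by case: ifP => // _; rewrite pair_entryC.
Qed.

Lemma sorted_pairs_dist D E : `|sorted_pairs D - sorted_pairs E| <= `|D - E|.
Proof.
apply: mx_norm_le => // i0 j; rewrite !mxE.
apply: nth_sort_dist => //; first by rewrite !size_map.
move=> l; rewrite size_map => ln.
have x0 : 'I_h * 'I_h by case: lt_pairs ln.
rewrite !(nth_map x0) //.
have : nth x0 lt_pairs l \in lt_pairs by exact: mem_nth.
case: (nth x0 lt_pairs l) => i k; rewrite mem_filter /= => /andP[ik _].
have nik : i != k by rewrite -val_eqE neq_ltn ik.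
have [a [b [ab [[-> ->]|[-> ->]]]]] := lohiP nik.
  rewrite !pair_entry_lohi //.
  by have := mx_norm_entry (D - E) a b; rewrite !mxE.
rewrite ![pair_entry _ (hi b) _]pair_entryC !pair_entry_lohi //.
by have := mx_norm_entry (D - E) a b; rewrite !mxE.
Qed.

End PairDistances.

(** * The [ADD] vector is 1-Lipschitz for [Minf] *)

Section DistancesToBasis.
Variables (R : realType) (T : metricType R).
Implicit Types C : {fset T}.

Lemma pair_entry_DM h (A : h.-tuple T) (i j : 'I_h) : i != j ->
  pair_entry (DM A) i j = mdist (tnth A i) (tnth A j).
Proof.
move=> /lohiP[a [b [ab [[-> ->]|[-> ->]]]]].
  by rewrite pair_entry_lohi // mxE ab.
by rewrite pair_entryC pair_entry_lohi // mxE ab metric_sym.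
Qed.

Lemma SDV_DM h (A : h.-tuple T) : SDV A = sorted_pairs (DM A).
Proof.
apply/rowP => i; rewrite !mxE; congr ((sort _ _)`_ _).
apply/eq_in_map => -[k l]; rewrite mem_filter /= => /andP[kl _].
by rewrite pair_entry_DM // -val_eqE neq_ltn kl.
Qed.

(** Both blocks of [ADD] are invariant under every [xi], so the first is controlled by the
    distance-matrix term of [dxi] and the second by its bottleneck term. *)
Lemma ADD_dist_le_Minf n h C C' (A A' : h.-tuple T) :
  `|ADD n C A - ADD n C' A'| <= Minf (RDD n C A) (RDD n C' A').
Proof.
have H xi : `|ADD n C A - ADD n C' A'| <=
    dxi (DM A, RM n C A) (DM A', RM n C' A') xi.
  apply: mx_norm_le => [|i j]; first by rewrite le_max normr_ge0.
  rewrite /ADD opp_row_mx add_row_mx le_max /= mxE.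
  case: (fintype.split j) => l; apply/orP; [left|right];
    apply: le_trans (mx_norm_entry _ i l) _.
    by rewrite !SDV_DM -(sorted_pairs_permD xi) sorted_pairs_dist.
  by rewrite -[Rvec n C A](sorted_avgs_permR xi) sorted_avgs_dist.
by rewrite /RDD Minf_pi; apply/bigmin_geP; split=> [|xi _].
Qed.

Lemma Minf_ge0 h n (X Y : rdd R h n) : 0 <= Minf X Y.
Proof.
have H xi : 0 <= dxi (repr X) (repr Y) xi by rewrite le_max normr_ge0.
by apply/bigmin_geP; split=> [|xi _].
Qed.

End DistancesToBasis.


(** * Listing the [h]-point subsets of a cloud and transporting them *)

Section BasisSequences.
Variables (R : realType) (T : metricType R).
Implicit Types C : {fset T}.

Lemma mem_basis_seqs h C (A : h.-tuple T) :
  reflect (exists2 B : {fset T}, B `<=` C & val A = enum_fset B)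
          (A \in basis_seqs h C).
Proof.
rewrite /basis_seqs mem_pmap_sub.
apply: (iffP (@mapP _ _ (fun B : {fset T} => enum_fset B) _ _)) => -[B BC eB];
  exists B => //; first by rewrite -fpowersetE.
by rewrite -[_ \in _]/(B \in fpowerset C) fpowersetE.
Qed.

Lemma basis_seqs_sub h C (A : h.-tuple T) :
  A \in basis_seqs h C -> uniq A /\ {subset A <= C}.
Proof.
case/mem_basis_seqs => B /fsubsetP BC eB; split=> [|x]; last first.
  by rewrite memtE eB => /BC.
by rewrite -[tval A]/(val A) eB fset_uniq.
Qed.

Lemma uniq_basis_seqs h C : uniq (basis_seqs h C).
Proof.
apply: pmap_sub_uniq.
rewrite (@map_inj_uniq _ _ (fun B : {fset T} => enum_fset B)) ?fset_uniq //.
by move=> A B e; apply/fsetP => x; rewrite -[LHS]/(x \in enum_fset A) e.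
Qed.

Lemma size_basis_seqs h C : size (basis_seqs h C) = 'C(#|` C|, h).
Proof.
rewrite /basis_seqs size_pmap_sub count_map.
have -> : 'C(#|` C|, h) = #|[set B : {set C} | #|B| == h]|.
  by rewrite card_draws cardfE.
(* [F] identifies the subsets of the finite type [C] with the finite subsets of [T] inside [C]; the
   former are counted by binomials. *)
pose F (Y : {set C}) : {fset T} := [fsetval y in Y].
have Finj : injective F.
  move=> X Y /fsetP eqXY; apply/setP => x.
  by have := eqXY (val x); rewrite !inE.
have : perm_eq (enum_fset (fpowerset C)) [seq F Y | Y <- enum {: {set C}}].
  apply: uniq_perm; rewrite ?fset_uniq ?map_inj_uniq -?enumT ?enum_uniq // => B.
  rewrite -[LHS]/(B \in fpowerset C); apply/imfsetP/mapP => /= -[Y _ ->].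
    by exists Y; rewrite ?mem_enum.
  by exists Y; rewrite ?powersetT ?inE.
move/seq.permP => ->; rewrite count_map cardE size_filter enumT.
apply: eq_count => Y /=.
by rewrite inE /F card_imfset //= -?cardE //; exact: val_inj.
Qed.

(* Each set of the second cloud is listed in its own order, unrelated to the
   order transported by [phi]; this is why [F] must ignore the order. *)
Lemma perm_basis_seqs (X : eqType) h C C' (phi : T -> T) (F : h.-tuple T -> X) :
    {in C &, injective phi} -> {in C, forall x, phi x \in C'} ->
    #|` C| = #|` C'| -> (forall A B : h.-tuple T, perm_eq A B -> F A = F B) ->
  perm_eq [seq F A | A <- basis_seqs h C']
          [seq F (map_tuple phi A) | A <- basis_seqs h C].
Proof.
move=> phi_inj phiC' eC FE.
(* [norm A] relists the image of [A] in the order of the finite set it forms. The default [A] is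
   never taken on basis sequences: injectivity of [phi] on [C] keeps the size equal to [h]. *)
pose norm (A : h.-tuple T) : h.-tuple T :=
  insubd A (enum_fset [fset x in map phi A]).
have imC (A : h.-tuple T) : A \in basis_seqs h C ->
    perm_eq (map phi A) (enum_fset [fset x in map phi A]).
  move=> /basis_seqs_sub[uA AC]; apply: uniq_perm; rewrite ?fset_uniq //.
    by rewrite map_inj_in_uniq // => x y /AC xC /AC yC; exact: phi_inj.
  by move=> x; rewrite -[RHS]/(x \in [fset x in map phi A]) !inE.
have normE (A : h.-tuple T) : A \in basis_seqs h C ->
    val (norm A) = enum_fset [fset x in map phi A].
  move=> bA; rewrite val_insubd.
  by rewrite -(perm_size (imC _ bA)) size_map size_tuple eqxx.
have norm_inj : {in basis_seqs h C &, injective norm}.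
  move=> A B bA bB /(congr1 val); rewrite !normE // => e.
  have eA : perm_eq (map phi A) (map phi B).
    by rewrite (perm_trans (imC _ bA)) // e perm_sym imC.
  have [uA AC] := basis_seqs_sub bA; have [uB BC] := basis_seqs_sub bB.
  case/mem_basis_seqs: bA => A0 _ eA0; case/mem_basis_seqs: bB => B0 _ eB0.
  apply/val_inj; rewrite eA0 eB0; congr enum_fset; apply/fsetP => x.
  rewrite -[LHS]/(x \in enum_fset A0) -[RHS]/(x \in enum_fset B0) -eA0 -eB0.
  have sub (U V : seq T) : {subset U <= C} -> {subset V <= C} ->
      perm_eq (map phi U) (map phi V) -> x \in U -> x \in V.
    move=> UC VC eUV xU; have := map_f phi xU.
    rewrite (perm_mem eUV) => /mapP[y yV /phi_inj -> //]; last exact: VC.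
    exact: UC.
  by apply/idP/idP; apply: sub => //; rewrite perm_sym.
have pn : perm_eq [seq norm A | A <- basis_seqs h C] (basis_seqs h C').
  have un : uniq [seq norm A | A <- basis_seqs h C].
    by rewrite map_inj_in_uniq // uniq_basis_seqs.
  apply: uniq_perm => //; first exact: uniq_basis_seqs.
  (* Both lists have the same binomial length, so the injection [norm] is onto. *)
  case: (@uniq_min_size _ _ (basis_seqs h C') un) => //.
    move=> _ /mapP[A bA ->]; apply/mem_basis_seqs.
    exists [fset x in map phi A]; last exact: normE.
    apply/fsubsetP => x; rewrite !inE => /mapP[y yA ->]; apply: phiC'.
    by case: (basis_seqs_sub bA) => _; apply.
  by rewrite size_map !size_basis_seqs eC.
rewrite perm_sym; apply: perm_trans (perm_map F pn); rewrite -map_comp.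
apply/seq.permP => a; congr (count _ _); apply/eq_in_map => A bA /=.
by apply: FE; rewrite [X in perm_eq _ X]normE // imC.
Qed.

End BasisSequences.

(** * Effect of a perturbation on one relative distance distribution *)

Section Perturbation.
Variables (R : realType) (T : metricType R).
Implicit Types C : {fset T}.

(** The matrix of [RM] before sorting, with the order of the outside points explicit so that columns
    can be matched. *)
Definition dist_mx n h (s : seq T) (A : h.-tuple T) : 'M[R]_(h, n) :=
  \matrix_(i, j) [seq mdist q (tnth A i) | q <- s]`_j.

Lemma dist_mxE n h (s : n.-tuple T) (A : h.-tuple T) i j :
  dist_mx n s A i j = mdist (tnth s j) (tnth A i).
Proof.
by rewrite mxE (nth_map (tnth s j)) ?size_tuple // -tnth_nth.
Qed.

Lemma RME n C h (A : h.-tuple T) :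
  RM n C A = sort_cols (dist_mx n [seq q <- enum_fset C | q \notin A] A).
Proof. by []. Qed.

(** The permutation that reorders [A] into [B] is itself the [xi] witnessing equivalence; the points
    outside are the same. *)
Lemma RDD_perm n C h (A B : h.-tuple T) : perm_eq A B -> RDD n C A = RDD n C B.
Proof.
move=> pAB; have [p eA] := tuple_permP pAB.
have {}eA i : tnth A i = tnth B (p i).
  have -> : A = [tuple tnth B (p i) | i < h] by exact: val_inj.
  by rewrite tnth_mktuple.
apply/eqquotP; apply/existsP; exists p; apply/andP; split; apply/eqP.
  apply/matrixP => a b; rewrite !mxE; case: ifP => ab; last by rewrite ab.
  rewrite pair_entry_DM ?(inj_eq perm_inj) ?lo_neq_hi //.
  by rewrite !eA !permKV.
rewrite /= !RME permR_sort sort_cols_id /permR; congr sort_cols.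
apply/matrixP => i j; rewrite !mxE eA permKV.
by congr (_`_ _); congr map; apply: eq_filter => q; rewrite (perm_mem pAB).
Qed.

Lemma Winf_sort_cols h n (M N : 'M[R]_(h, n)) :
  Winf (sort_cols M) (sort_cols N) = Winf M N.
Proof.
have [t ->] := sort_cols_perm M; have [u ->] := sort_cols_perm N.
exact: Winf_col_perm.
Qed.

Lemma mdist_perturb (eps : R) (x y x' y' : T) :
  mdist x x' <= eps -> mdist y y' <= eps ->
  `|mdist x y - mdist x' y'| <= 2 * eps.
Proof.
move=> hx hy; rewrite ler_distlC.
have t1 := metric_triangle x x' y; have t2 := metric_triangle x' y' y.
have t3 := metric_triangle x' x y'; have t4 := metric_triangle x y y'.
by rewrite (metric_sym y' y) in t2; rewrite (metric_sym x' x) in t3; lra.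
Qed.

Lemma Winf_dist_mx_perturb (eps : R) n h (phi : T -> T) (s : n.-tuple T)
    (s' : seq T) (A : h.-tuple T) : 0 <= eps ->
    perm_eq s' (map phi s) ->
    (forall j, mdist (tnth s j) (phi (tnth s j)) <= eps) ->
    (forall i, mdist (tnth A i) (phi (tnth A i)) <= eps) ->
  Winf (dist_mx n s A) (dist_mx n s' (map_tuple phi A)) <= 2 * eps.
Proof.
move=> eps0 /(@tuple_permP _ _ _ (map_tuple phi s))[p ->] s_eps A_eps.
have e20 : 0 <= 2 * eps by rewrite mulr_ge0.
(* Entry [j] of [s'] is the image of entry [p j] of [s], so column [j] must be matched with column
   [p^-1 j]. *)
apply: le_trans (_ : bottleneck_cost _ _ (p^-1)%g <= _).
  exact: bigmin_le_cond.
apply/bigmax_leP; split=> // j _; apply: mx_norm_le => // i i0.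
have colB (M N : 'M[R]_(h, n)) k : (col j M - col k N) i i0 = M i j - N i k.
  by rewrite !mxE.
rewrite colB !dist_mxE !tnth_map tnth_ord_tuple permKV.
exact: mdist_perturb.
Qed.

Lemma Minf_perturb (eps : R) n h C C' (phi : T -> T) (A : h.-tuple T) :
    {in C &, injective phi} -> perm_eq (map phi C) C' ->
    {in C, forall x, mdist x (phi x) <= eps} -> 0 <= eps ->
    uniq A -> {subset A <= C} -> (#|` C| = n + h)%N ->
  Minf (RDD n C A) (RDD n C' (map_tuple phi A)) <= 2 * eps.
Proof.
move=> phi_inj phiC phi_eps eps0 uA AC cC.
rewrite /RDD Minf_pi; set x := (_, _); set y := (_, _).
(* [map_tuple phi A] keeps the order of [A], so the identity will do. *)
apply: le_trans (_ : dxi x y 1%g <= _); first exact: bigmin_le_cond.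
have e20 : 0 <= 2 * eps by rewrite mulr_ge0.
have AC' i : tnth A i \in C by apply: AC; exact: mem_tnth.
rewrite /dxi permD1 permR1 ge_max; apply/andP; split.
  apply: mx_norm_le => // a b; rewrite !mxE.
  case: ifP => ab; last by rewrite subrr normr0.
  by rewrite !tnth_map mdist_perturb // phi_eps.
rewrite /= !RME sort_cols_id Winf_sort_cols.
set s := [seq q <- enum_fset C | q \notin A].
have ss : size s == n.
  have : perm_eq [seq q <- enum_fset C | q \in A] A.
    apply: uniq_perm; rewrite ?filter_uniq ?fset_uniq // => q.
    by rewrite mem_filter; case: (boolP (q \in A)) => //= /AC.
  move/perm_size; rewrite size_tuple size_filter => cA.
  apply/eqP/(@addIn h); rewrite size_filter -cC.
  rewrite -[RHS](count_predC (mem A) (enum_fset C)) [RHS]addnC.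
  by congr (_ + _)%N; exact: esym cA.
(* Injectivity on [C] makes [phi] send the points outside [A] exactly to those outside its image. *)
have ps : perm_eq [seq q <- enum_fset C' | q \notin map_tuple phi A]
    (map_tuple phi (Tuple ss)).
  rewrite perm_sym /= -(eq_filter (a1 := predC (mem (map phi A)))) //.
  apply: perm_trans (perm_filter _ phiC); rewrite filter_map.
  rewrite /s; apply/seq.permP => a; congr (count _ (map _ _)).
  apply: eq_in_filter => q qC /=; congr (~~ _).
  apply/idP/mapP => [qA|[q' q'A /phi_inj ->//]]; first by exists q.
  exact: AC.
apply: (@Winf_dist_mx_perturb _ _ _ _ (Tuple ss)) => // [j|i];
  apply: phi_eps => //.
by have := mem_tnth j (Tuple ss); rewrite memtE mem_filter => /andP[].
Qed.

End Perturbation.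


(** * Comparison of whole distributions *)

(** The bijection is extended by the identity off [C], so that it can be mapped over tuples;
    injectivity is kept on [C] only. *)
Lemma perturbation_fun (R : realType) (T : metricType R) (eps : R)
    (C C' : {fset T}) : perturbation eps C C' ->
  exists phi : T -> T, [/\ {in C &, injective phi}, perm_eq (map phi C) C'
    & {in C, forall x, mdist x (phi x) <= eps}].
Proof.
case=> f [[g fK gK] f_eps].
pose phi (x : T) := if insub x is Some u then val (f u) else x.
have phiE (u : C) : phi (val u) = val (f u) by rewrite /phi valK.
have phi_inj : {in C &, injective phi}.
  move=> x y xC yC; rewrite -[x]/(val [` xC]) -[y]/(val [` yC]) !phiE.
  by move=> /val_inj /(can_inj fK) ->.
exists phi; split=> // [|x xC]; last by rewrite -[x]/(val [` xC]) phiE.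
apply: uniq_perm; rewrite ?fset_uniq //.
  by rewrite map_inj_in_uniq ?fset_uniq.
move=> y; apply/mapP/idP => [[x xC ->]|yC].
  by rewrite -[x]/(val [` xC]) phiE; exact: valP.
by exists (val (g [` yC])); [exact: valP | rewrite phiE gK].
Qed.

Section SDDs.
Variables (R : realType) (T : metricType R) (m h : nat).
Implicit Types C : {fset T}.

Lemma SDD_cost_ge0 (S S' : {mset rdd R h (m - h)}%mset) i j :
  0 <= SDD_cost S S' i j.
Proof. by rewrite mxE Minf_ge0. Qed.

Lemma SDM_dist_le_EMD C C' : #|` C| = m -> #|` C'| = m -> (h <= m)%N ->
  `|SDM m h C - SDM m h C'| <= EMD_SDD (SDD m h C) (SDD m h C').
Proof.
move=> cC cC' hm.
have k0 : (0 < 'C(m, h))%N by rewrite bin_gt0.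
(* The basis sequences are reordered to follow the listing of the multiset; the average [SDM] does
   not see this order. *)
have list D : #|` D| = m -> exists b : 'C(m, h).-tuple (h.-tuple T),
    (forall x0 (i : 'I_('C(m, h))),
       nth x0 (SDD m h D) i = RDD (m - h) D (tnth b i)) /\
    SDM m h D = \sum_(i < 'C(m, h)) 'C(m, h)%:R^-1 *: ADD (m - h) D (tnth b i).
  move=> cD; have sb : size (basis_seqs h D) == 'C(m, h).
    by rewrite size_basis_seqs cD.
  have pS := perm_eq_seq_mset [seq RDD (m - h) D A | A <- Tuple sb].
  have [p Hp] : exists p : 'S_('C(m, h)), forall x0 (i : 'I_('C(m, h))),
     nth x0 (SDD m h D) i = RDD (m - h) D (tnth (Tuple sb) (p i)).
    have [p Hp] := perm_map_index (\pi_(rdd R h (m - h))%qT (0, 0)) pS.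
    exists p => x0 i; rewrite -Hp; apply: set_nth_default.
    by rewrite (perm_size pS) size_map size_tuple.
  exists [tuple tnth (Tuple sb) (p i) | i < 'C(m, h)]; split.
    by move=> x0 i; rewrite Hp tnth_mktuple.
  rewrite -scaler_sumr /SDM; congr (_ *: _).
  rewrite -[basis_seqs h D]/(tval (Tuple sb)) big_tuple.
  rewrite [LHS](reindex_inj (@perm_inj _ p)) /=.
  by apply: eq_bigr => i _; rewrite tnth_mktuple.
have [b [Hb ->]] := list C cC; have [b' [Hb' ->]] := list C' cC'.
have kV0 (i : 'I_('C(m, h))) : 0 <= 'C(m, h)%:R^-1 :> R by rewrite invr_ge0.
have kV1 : \sum_(i < 'C(m, h)) 'C(m, h)%:R^-1 = 1 :> R.
  by rewrite sumr_const card_ord -[LHS]mulr_natl mulfV // pnatr_eq0 -lt0n.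
apply: (EMD_ge_dist kV0 kV0 kV1 kV1) => i j.
by rewrite mxE Hb Hb' ADD_dist_le_Minf.
Qed.

Lemma SDD_matching (eps : R) C C' : perturbation eps C C' -> 0 <= eps ->
    #|` C| = m -> (h <= m)%N ->
  exists g : 'S_('C(m, h)),
    forall i, SDD_cost (SDD m h C) (SDD m h C') i (g i) <= 2 * eps.
Proof.
move=> /perturbation_fun[phi [phi_inj phiC phi_eps]] eps0 cC hm.
have eC : #|` C| = #|` C'| by rewrite -(perm_size phiC) size_map.
have phiC' : {in C, forall x, phi x \in C'}.
  move=> x xC; rewrite -[_ \in _]/(phi x \in enum_fset C').
  by rewrite -(perm_mem phiC) map_f.
have sb : size (basis_seqs h C) == 'C(m, h) by rewrite size_basis_seqs cC.
pose b := Tuple sb.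
have pS : perm_eq (SDD m h C) (map (fun A => RDD (m - h) C A) b).
  exact: perm_eq_seq_mset.
have pS' : perm_eq (SDD m h C')
    (map (fun A => RDD (m - h) C' (map_tuple phi A)) b).
  apply: perm_trans (perm_eq_seq_mset _) _; apply: perm_basis_seqs => // A B.
  exact: RDD_perm.
have [p Hp] := perm_map_index (\pi_(rdd R h (m - h))%qT (0, 0)) pS.
have [q Hq] := perm_map_index (\pi_(rdd R h (m - h))%qT (0, 0)) pS'.
(* Item [i] for [C] comes from [b] at [p i], item [j] for [C'] from the image of [b] at [q j]; they
   correspond when [j] is [q^-1 (p i)]. *)
exists (p * q^-1)%g => i; rewrite mxE Hp Hq permM permKV.
have [uA AC] := basis_seqs_sub (mem_tnth (p i) b : _ \in basis_seqs h C).
by apply: Minf_perturb => //; rewrite subnK.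
Qed.

End SDDs.

Theorem theorem5p8 (R : realType) (T : metricType R) (eps : R) (m h : nat)
    (C C' : {fset T}) (hC : #|` C| = m) (hCC' : perturbation eps C C')
    (h1 : (1 <= h)%N) (hm : (h < m)%N) :
  [/\ LAC_SDD (SDD m h C) (SDD m h C') <= 2 * eps,
      EMD_SDD (SDD m h C) (SDD m h C') <= 2 * eps
    & `|SDM m h C - SDM m h C'| <= EMD_SDD (SDD m h C) (SDD m h C')].
Proof.
have le_hm := ltnW hm.
have k0 : (0 < 'C(m, h))%N by rewrite bin_gt0.
(* [C] has a point, and its displacement lies between 0 and [eps]. *)
have eps0 : 0 <= eps.
  have : C != fset0 by rewrite -cardfs_gt0 hC (leq_ltn_trans _ hm).
  case/fset0Pn => x xC; have [f [_ /(_ [` xC])]] := hCC'.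
  exact/le_trans/mdist_ge0.
have cC' : #|` C'| = m.
  have [phi [_ phiC _]] := perturbation_fun hCC'.
  by rewrite -(perm_size phiC) size_map.
have [g Hg] := SDD_matching hCC' eps0 hC le_hm.
have LAC2 := LAC_le k0 Hg.
split=> //; last exact: SDM_dist_le_EMD.
by apply: le_trans LAC2; apply: EMD_le_LAC => // i j; exact: SDD_cost_ge0.
Qed.
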